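(* Let $\mathcal{X}=\{z_1,\dots,z_N\}\subset\mathbb{R}^d$ be a finite alphabet, let $m\ge2$, $\psi_1,\dots,\psi_K:\mathcal{X}\to\mathbb{R}$, let $\hat Q_1,\dots,\hat Q_m$ be empirical distributions of finite training sequences in $\mathcal{X}$, and let $\eta\in(0,\eta_{\max})$. Consider the minmax problem $$\min_{\phi_{i,N}\in[0,1]^N,\,i\in[m]}\ \max_{P_{i,N}\in[0,1]^N,\,i\in[m]}\ 1-\frac1m\sum_{i=1}^m\phi_{i,N}^TP_{i,N}$$ subject to $\left|\sum_{j=1}^N p_{i,N}(z_j)\psi_k(z_j)-E_{\hat Q_i}[\psi_k]\right|\le\eta$ for all $k\in[K]$, $i\in[m]$; $P_{i,N}^T\mathbf{1}=1$ for all $i\in[m]$; and $\sum_{i=1}^m\phi_{i,N}(z_j)=1$ for all $j\in[N]$. This minmax problem can be reformulated as the minimization problem $$\min\ \ 1-\sum_{i=1}^m\sum_{k=1}^K\lambda_{i,k}^{\ell}a_{i,k}+\sum_{i=1}^m\sum_{k=1}^K\lambda_{i,k}^{u}b_{i,k}-\sum_{i=1}^m\mu_i$$ over $\phi_{i,N}\in[0,1]^N$ ($i\in[m]$), $\lambda_{i,k}^{\ell},\lambda_{i,k}^{u}\ge0$ ($k\in[K]$, $i\in[m]$) and $\mu_1,\dots,\mu_m\in\mathbb{R}$, subject to $$\frac1m\phi_{i,N}(z_j)-\sum_{k=1}^K\lambda_{i,k}^{\ell}\psi_k(z_j)+\sum_{k=1}^K\lambda_{i,k}^{u}\psi_k(z_j)-\mu_i\ge0,\quad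 j\in[N],\ i\in[m],$$ $$\sum_{i=1}^m\phi_{i,N}(z_j)=1,\quad j\in[N],$$ where $a_{i,k}=E_{\hat Q_i}[\psi_k]-\eta$ and $b_{i,k}=E_{\hat Q_i}[\psi_k]+\eta$. That is, the two problems have the same optimal value and the same optimal decision rules $(\phi_{1,N},\dots,\phi_{m,N})$.
   Context: $[n]=\{1,\dots,n\}$. For each $i\in[m]$, $\hat Q_i=\frac1{n_i}\sum_{j=1}^{n_i}\delta(\hat x_{i,j})$ is the empirical distribution of training points $\hat x_{i,1},\dots,\hat x_{i,n_i}\in\mathcal{X}$, and $E_P[\psi]$ denotes the expectation of $\psi(X)$ under $X\sim P$. $\phi_{i,N}=[\phi_{i,N}(z_1),\dots,\phi_{i,N}(z_N)]^T$, where $\phi_{i,N}(z_j)$ is the probability that the randomized test accepts hypothesis $i$ upon observing $z_j$; $P_{i,N}=[p_{i,N}(z_1),\dots,p_{i,N}(z_N)]^T$ is a probability mass function; $\mathbf{1}$ is the all-ones vector. $\eta_{\max}>0$ is the maximum (supremal) radius for which the uncertainty sets $\mathcal{P}_i^\eta=\{P \text{ a probability measure on }\mathcal{X}: |E_P[\psi_k]-E_{\hat Q_i}[\psi_k]|\le\eta,\ k\in[K]\}$, $i\in[m]$, do not overlap (are pairwise disjoint). A decision rule is optimal for the minmax problem if it attains the outer minimum, and optimal for the minimization problem if it is the $\phi$-component of some optimal solution. *)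

(* Defs.v *)
From HB Require Import structures.
From mathcomp Require Import all_boot all_order all_algebra.
From mathcomp Require Import all_classical all_reals all_analysis.

Set Implicit Arguments.
Unset Strict Implicit.
Unset Printing Implicit Defensive.

Import Order.TTheory GRing.Theory Num.Theory.

Local Open Scope classical_set_scope.
Local Open Scope ring_scope.

(* The alphabet {z_1, ..., z_N} as a type: the points of R^d listed in z, with
   the discrete sigma-algebra.  It has N.+1 letters because measurable types
   are pointed. *)
Definition alphabet (R : realType) (d N : nat) (z : N.+1.-tuple 'rV[R]_d) : Type :=
  seq_sub z.

Definition letter (R : realType) (d N : nat) (z : N.+1.-tuple 'rV[R]_d)
  (j : 'I_N.+1) : alphabet z := SeqSub (mem_tnth j z).

HB.instance Definition _ (R : realType) (d N : nat) (z : N.+1.-tuple 'rV[R]_d) :=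
  Finite.copy (alphabet z) (seq_sub z).

HB.instance Definition _ (R : realType) (d N : nat) (z : N.+1.-tuple 'rV[R]_d) :=
  isPointed.Build (alphabet z) (letter z ord0).

HB.instance Definition _ (R : realType) (d N : nat) (z : N.+1.-tuple 'rV[R]_d) :=
  @isMeasurable.Build default_measure_display (alphabet z)
    discrete_measurable discrete_measurable0
    discrete_measurableC discrete_measurableU.

Section empirical.
Context {disp : measure_display} {T : measurableType disp} (R : realType).
Variables (n : nat) (x : n.+1.-tuple T).

(* (1 / n.+1) * the sum of the Dirac measures at the entries of x.  msum is
   indexed by nat; the default value point of nth is never reached. *)
Definition empirical : set T -> \bar R :=
  mscale ((n.+1%:R^-1 : R)%:nng) (msum (fun k => \d_(nth point x k)) n.+1).

HB.instance Definition _ := Measure.on empirical.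

Let empirical_setT : empirical setT = 1%E.
Proof.
rewrite /empirical /mscale /= /msum.
rewrite (eq_bigr (fun=> 1%E)); last by move=> k _; exact: diracT.
rewrite sumEFin sumr_const card_ord -EFinM mulVf //.
Qed.

HB.instance Definition _ :=
  Measure_isProbability.Build _ _ _ empirical empirical_setT.

End empirical.

Section robust_testing.
Context {R : realType} {d N m K : nat}.
Variable z : N.+1.-tuple 'rV[R]_d.
Variable psi : 'I_K -> alphabet z -> R.
Variables (n : 'I_m -> nat) (xhat : forall i : 'I_m, (n i).+1.-tuple (alphabet z)).

Definition Qhat (i : 'I_m) : probability (alphabet z) R := empirical R (xhat i).

Definition mean (P : probability (alphabet z) R) (f : alphabet z -> R) : R :=
  fine 'E_P[f].

Definition uncertainty_set (r : R) (i : 'I_m) : set (probability (alphabet z) R) :=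
  [set P | forall k, `|mean P (psi k) - mean (Qhat i) (psi k)| <= r].

(* Extended-real, so that no radius lies below it when the sets overlap for
   every r >= 0 (the supremum is then -oo rather than a default real). *)
Definition eta_max : \bar R :=
  ereal_sup [set r%:E | r in
    [set r : R | 0 <= r /\ trivIset setT (uncertainty_set r)]].

Variable eta : R.

Definition in_unit_box (v : 'cV[R]_N.+1) : Prop := forall j, 0 <= v j 0 <= 1.

Definition decision_rule (phi : 'I_m -> 'cV[R]_N.+1) : Prop :=
  (forall i, in_unit_box (phi i)) /\ (forall j, \sum_(i < m) phi i j 0 = 1).

Definition risk (phi P : 'I_m -> 'cV[R]_N.+1) : R :=
  1 - m%:R^-1 * \sum_(i < m) ((phi i)^T *m P i) 0 0.

Definition minmax_constraint (P : 'I_m -> 'cV[R]_N.+1) : Prop :=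
  [/\ forall i, in_unit_box (P i),
      forall i k, `|\sum_(j < N.+1) P i j 0 * psi k (letter z j)
                    - mean (Qhat i) (psi k)| <= eta
    & forall i, (P i)^T *m const_mx 1 = 1%:M].

Definition worst_risk (phi : 'I_m -> 'cV[R]_N.+1) : \bar R :=
  ereal_sup [set (risk phi P)%:E | P in minmax_constraint].

Definition minmax_value : \bar R :=
  ereal_inf [set worst_risk phi | phi in decision_rule].

Definition minmax_optimal (phi : 'I_m -> 'cV[R]_N.+1) : Prop :=
  decision_rule phi /\ worst_risk phi = minmax_value.

Definition lower_moment (i : 'I_m) (k : 'I_K) : R := mean (Qhat i) (psi k) - eta.
Definition upper_moment (i : 'I_m) (k : 'I_K) : R := mean (Qhat i) (psi k) + eta.

Definition min_objective (ll lu : 'I_m -> 'I_K -> R) (mu : 'I_m -> R) : R :=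
  1 - \sum_(i < m) \sum_(k < K) ll i k * lower_moment i k
    + \sum_(i < m) \sum_(k < K) lu i k * upper_moment i k
    - \sum_(i < m) mu i.

Definition min_constraint (phi : 'I_m -> 'cV[R]_N.+1)
    (ll lu : 'I_m -> 'I_K -> R) (mu : 'I_m -> R) : Prop :=
  [/\ forall i, in_unit_box (phi i),
      forall i k, 0 <= ll i k,
      forall i k, 0 <= lu i k,
      forall j i, 0 <= m%:R^-1 * phi i j 0
                       - \sum_(k < K) ll i k * psi k (letter z j)
                       + \sum_(k < K) lu i k * psi k (letter z j)
                       - mu i
    & forall j, \sum_(i < m) phi i j 0 = 1].

Definition min_value : \bar R :=
  ereal_inf [set v | exists phi ll lu mu,
    min_constraint phi ll lu mu /\ v = (min_objective ll lu mu)%:E].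

Definition min_optimal (phi : 'I_m -> 'cV[R]_N.+1) : Prop :=
  exists ll lu mu, min_constraint phi ll lu mu /\
    (min_objective ll lu mu)%:E = min_value.

End robust_testing.

(* Main.v *)
From HB Require Import structures.
Require Import Defs.
From mathcomp Require Import all_boot all_order all_algebra.
From mathcomp Require Import all_classical all_reals all_analysis.
From mathcomp Require Import ring lra.

(* For a fixed decision rule the inner maximum splits into m linear programs
   over the moment polytopes, which are nonempty because they contain the
   empirical distributions; strong duality turns each into a minimum over
   (lambda^l, lambda^u, mu), and the two minima merge.  The outer minimum is
   attained because the merged problem is itself a linear program that weak
   duality bounds below.

   Both attainment and strong duality come from Fourier-Motzkin elimination:
   the set of t such that some feasible x has cost at most t is cut out by
   finitely many inequalities in t, each a nonnegative combination of the
   constraints, so its least element is attained and the inequality binding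
   there is an optimal dual solution. *)

Set Implicit Arguments.
Unset Strict Implicit.
Unset Printing Implicit Defensive.

Import Order.TTheory GRing.Theory Num.Theory.

Local Open Scope classical_set_scope.
Local Open Scope ring_scope.

(** * Fourier-Motzkin elimination *)

(** Each [i] with [a i 0 > 0] bounds [t] below by [b i 0 / a i 0], and each with [a i 0 < 0] bounds
    it above. A suitable [t] exists iff every lower bound is at most every upper bound and
    [b i 0 <= 0] wherever [a i 0 = 0]. With denominators cleared, these conditions are the rows of
    [B]; pairs with other signs give zero rows. *)
Lemma eliminate_variable (R : realFieldType) (p : nat) (a : 'cV[R]_p) :
  exists r (B : 'M[R]_(r, p)), [/\ forall s i, 0 <= B s i, B *m a = 0 &
    forall b : 'cV_p, (exists t : R, forall i, b i 0 <= a i 0 * t) <->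
      (forall s, (B *m b) s 0 <= 0)].
Proof.
pose row_of (s : 'I_p + 'I_p * 'I_p) : 'rV[R]_p := match s with
  | inl i => (a i 0 == 0)%:R *: delta_mx 0 i
  | inr ij => if a ij.2 0 < 0 < a ij.1 0
              then a ij.1 0 *: delta_mx 0 ij.2 - a ij.2 0 *: delta_mx 0 ij.1
              else 0 end.
have dmul (i : 'I_p) (b : 'cV[R]_p) :
    ((delta_mx 0 i : 'rV[R]_p) *m b) 0 0 = b i 0 by rewrite -rowE mxE.
have dmulZ c (i : 'I_p) (b : 'cV[R]_p) :
    ((c *: delta_mx 0 i : 'rV[R]_p) *m b) 0 0 = c * b i 0.
  by rewrite -scalemxAl mxE dmul.
have dmulB c c' (i j : 'I_p) (b : 'cV[R]_p) :
    ((c *: delta_mx 0 i - c' *: delta_mx 0 j : 'rV[R]_p) *m b) 0 0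
      = c * b i 0 - c' * b j 0.
  by rewrite mulmxBl mxE dmulZ mxE dmulZ.
exists #|{: 'I_p + 'I_p * 'I_p}|, (\matrix_(s < _) row_of (enum_val s)).
have rowM b s : (\matrix_(s < _) row_of (enum_val s) *m b) s 0 =
    (row_of (enum_val s) *m b) 0 0 :> R.
  by rewrite [LHS]mxE [RHS]mxE; apply: eq_bigr => k _; rewrite [in LHS]mxE.
split=> [s i||b].
- rewrite mxE; case: (enum_val s) => [j|[j k]] /=.
    by rewrite !mxE -natrM ler0n.
  case: ifP => [/andP[k0 j0]|_]; rewrite !mxE ?lexx // subr_ge0.
  apply: (@le_trans _ _ 0); first by rewrite nmulr_rle0 // ler0n.
  by rewrite mulr_ge0 ?ler0n // ltW.
- apply/matrixP => s o; rewrite ord1 rowM [RHS]mxE.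
  case: (enum_val s) => [j|[j k]] /=.
    by rewrite dmulZ; case: eqP => [->|_]; rewrite ?mulr0 ?mul0r.
  case: ifP => _; last by rewrite mul0mx mxE.
  by rewrite dmulB mulrC subrr.
split=> [[t bt] s|Bb].
  rewrite rowM; case: (enum_val s) => [j|[j k]] /=.
    rewrite dmulZ; case: eqP => [a0|_]; last by rewrite mul0r.
    by rewrite mul1r (le_trans (bt j)) // a0 mul0r.
  case: ifP => [/andP[k0 j0]|_]; last by rewrite mul0mx mxE.
  rewrite dmulB.
  have := bt j; have := bt k; nra.
have {}Bb s : (row_of s *m b) 0 0 <= 0.
  by have := Bb (enum_rank s); rewrite rowM enum_rankK.
have b_zero i : a i 0 = 0 -> b i 0 <= 0.
  by move=> ai0; have := Bb (inl i); rewrite /= ai0 eqxx dmulZ mul1r.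
have b_pair i j : a j 0 < 0 -> 0 < a i 0 -> b i 0 / a i 0 <= b j 0 / a j 0.
  move=> j0 i0; have := Bb (inr (i, j)).
  rewrite /= j0 i0 dmulB => h.
  by rewrite ler_pdivrMr // mulrAC ler_ndivlMr //; lra.
pose pos := [pred i : 'I_p | 0 < a i 0]; pose neg := [pred i : 'I_p | a i 0 < 0].
suff [t [tpos tneg]] : exists t, (forall i, pos i -> b i 0 / a i 0 <= t) /\
    (forall i, neg i -> t <= b i 0 / a i 0).
  exists t => i; case: (ltgtP (a i 0) 0) => [i0|i0|i0].
  - by have := tneg _ i0; rewrite ler_ndivlMr // mulrC.
  - by have := tpos _ i0; rewrite ler_pdivrMr // mulrC.
  - by rewrite i0 mul0r b_zero.
(* Take the largest lower bound if there is one, else the smallest upper bound, else 0. *)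
have [i0 i0pos|nopos] := pickP pos.
  case: (@arg_maxP _ _ _ i0 pos (fun i => b i 0 / a i 0) i0pos) => i ipos imax.
  by exists (b i 0 / a i 0); split=> // j jneg; apply: b_pair.
have [i0 i0neg|noneg] := pickP neg.
  case: (@arg_minP _ _ _ i0 neg (fun i => b i 0 / a i 0) i0neg) => i ineg imin.
  by exists (b i 0 / a i 0); split=> // j; rewrite nopos.
by exists 0; split=> j; rewrite ?nopos ?noneg.
Qed.

(** Eliminating the first column leaves a system of the same shape in the other variables, so the
    elimination matrices multiply up. [B] is chosen before [b], so it also serves a right-hand side
    that varies with a parameter. *)
Lemma fourier_motzkin (R : realFieldType) (p q : nat) (A : 'M[R]_(p, q)) :
  exists r (B : 'M[R]_(r, p)), [/\ forall s i, 0 <= B s i, B *m A = 0 &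
    forall b : 'cV_p, (exists x : 'cV_q, forall i, b i 0 <= (A *m x) i 0) <->
      (forall s, (B *m b) s 0 <= 0)].
Proof.
elim: q => [|q IHq] in p A *.
  exists p, 1%:M; split=> [s i||b]; first by rewrite mxE ler0n.
    by apply/matrixP => i [].
  rewrite mul1mx; split=> [[x bx] s|b0]; first by have := bx s; rewrite mxE big_ord0.
  by exists 0 => i; rewrite mulmx0 mxE.
rewrite -[q.+1]/(1 + q)%N in A *.
have [r1 [B1 [B1ge0 B1A B1P]]] := eliminate_variable (lsubmx A).
have [r2 [B2 [B2ge0 B2A B2P]]] := IHq _ (B1 *m rsubmx A).
exists r2, (B2 *m B1); split=> [s i||b].
- by rewrite mxE sumr_ge0 // => k _; rewrite mulr_ge0.
- rewrite -[A]hsubmxK mul_mx_row -!mulmxA B1A mulmx0 B2A.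
  by rewrite row_mx0.
have xE (x : 'cV[R]_(1 + q)) i :
    (A *m x) i 0 = lsubmx A i 0 * usubmx x 0 0 + (rsubmx A *m dsubmx x) i 0.
  by rewrite -{1}[A]hsubmxK -{1}[x]vsubmxK mul_row_col mxE [X in X + _]mxE big_ord1.
rewrite -mulmxA; split=> [[x bx]|].
  apply/B2P; exists (dsubmx x) => i; rewrite -subr_le0 -mulmxA.
  have /B1P/(_ i) : exists t, forall i, (b - rsubmx A *m dsubmx x) i 0 <= lsubmx A i 0 * t.
    by exists (usubmx x 0 0) => k; rewrite !mxE; have := bx k; rewrite xE !mxE; lra.
  by rewrite mulmxBr !mxE.
case/B2P => x' bx'.
have /B1P[t bt] : forall s, (B1 *m (b - rsubmx A *m x')) s 0 <= 0.
  by move=> s; have := bx' s; rewrite mulmxBr -mulmxA !mxE subr_le0.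
exists (col_mx t%:M x') => i; rewrite xE col_mxKu col_mxKd [t%:M _ _]mxE mulr1n.
by have := bt i; rewrite !mxE; lra.
Qed.

(** * Linear programming duality *)

(** The bound [c x <= t] joins the system as a last row [- c], and eliminating [x] leaves
    [B1 b <= t B2]. Dividing a row by its entry in [B2], when positive, turns [B1 A = B2 c] into
    [y A = c]. *)
Lemma linear_program_duality_mx (R : realFieldType) (p q : nat)
  (A : 'M[R]_(p, q)) (b : 'cV[R]_p) (c : 'rV[R]_q) (x0 : 'cV[R]_q) (t0 : R) :
  (forall i, b i 0 <= (A *m x0) i 0) ->
  (forall x : 'cV_q, (forall i, b i 0 <= (A *m x) i 0) -> t0 <= (c *m x) 0 0) ->
  exists (x : 'cV_q) (y : 'rV_p), [/\ forall i, b i 0 <= (A *m x) i 0,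
    forall i, 0 <= y 0 i, y *m A = c & (y *m b) 0 0 = (c *m x) 0 0].
Proof.
move=> x0P t0P.
have [r [B [Bge0 BA BP]]] := fourier_motzkin (col_mx A (- c)).
pose B1 := lsubmx B; pose B2 := rsubmx B.
have B1A : B1 *m A = B2 *m c.
  apply/eqP; rewrite -subr_eq0 -mulmxN -mul_row_col hsubmxK BA //.
have feasP t : (exists x : 'cV_q, (forall i, b i 0 <= (A *m x) i 0) /\ (c *m x) 0 0 <= t)
    <-> forall s, (B1 *m b) s 0 <= B2 s 0 * t.
  transitivity (forall s, (B *m col_mx b (- t)%:M) s 0 <= 0); last first.
    split=> h s; have := h s;
    by rewrite -[B]hsubmxK mul_row_col mul_mx_scalar !mxE; lra.
  rewrite -BP; split=> [[x [bx ct]]|[x bx]].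
    exists x => i; rewrite mul_col_mx; case: (split_ordP i) => j ->.
      by rewrite !col_mxEu.
    by rewrite !col_mxEd ord1 mulNmx !mxE mulr1n lerN2; rewrite mxE in ct.
  exists x; split=> [i|]; first by have := bx (lshift 1 i); rewrite mul_col_mx !col_mxEu.
  have := bx (rshift p 0); rewrite mul_col_mx !col_mxEd mulNmx [X in X <= _]mxE mulr1n.
  by rewrite [X in _ <= X]mxE lerN2.
have feas0 : forall s, (B1 *m b) s 0 <= B2 s 0 * (c *m x0) 0 0 by apply/feasP; exists x0.
have B2ge0 s : 0 <= B2 s 0 by rewrite mxE.
pose bounding := [pred s : 'I_r | 0 < B2 s 0].
(* If no entry of [B2] is positive, nothing bounds [t] below, and a cost of at most [t0 - 1] would
   be reached. *)
have [s0 s0b|unb] := pickP bounding; last first.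
  have B20 s : B2 s 0 = 0.
    by apply/eqP; have := unb s; rewrite /= lt_def B2ge0 andbT => /negbFE.
  have /feasP[x [/t0P t0x]] : forall s, (B1 *m b) s 0 <= B2 s 0 * (t0 - 1).
    by move=> s; have := feas0 s; rewrite B20 !mul0r.
  by move=> /(le_trans t0x); rewrite lerBrDr gerDl ler10.
(* The largest ratio is the least feasible [t], and its row yields [y]. *)
case: (@arg_maxP _ _ _ s0 bounding (fun s => (B1 *m b) s 0 / B2 s 0) s0b) => s sb smax.
have /feasP[x [bx xt]] : forall s', (B1 *m b) s' 0 <= B2 s' 0 * ((B1 *m b) s 0 / B2 s 0).
  move=> s'; have [s'b|] := ltP 0 (B2 s' 0).
    by rewrite mulrC -ler_pdivrMr //; apply: smax.
  move=> s'0; have B20 : B2 s' 0 = 0 by apply: le_anti; rewrite s'0 B2ge0.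
  by have := feas0 s'; rewrite B20 !mul0r.
pose y := (B2 s 0)^-1 *: row s B1.
have yA : y *m A = c.
  rewrite -scalemxAl -row_mul B1A row_mul.
  rewrite [row s B2]mx11_scalar mul_scalar_mx scalerA [row s B2 0 0]mxE mulVf ?scale1r //.
  by rewrite gt_eqF.
have y0 i : 0 <= y 0 i by rewrite mxE mulr_ge0 ?invr_ge0 // !mxE.
(* One inequality is weak duality, [y b <= y A x = c x]; the other is the cost bound on [x]. *)
exists x, y; split=> //; apply/le_anti/andP; split.
  rewrite -yA -mulmxA mxE [X in _ <= X]mxE ler_sum // => i _.
  by rewrite ler_wpM2l.
by rewrite (le_trans xt) // -scalemxAl [leRHS]mxE -row_mul [row s _ 0 0]mxE mulrC.
Qed.

(** Coordinates in a basis of [V] reduce this to matrices. Stating it for a space and a finite index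
    type lets variables form a product and constraints a sum type, without flattening either by
    hand. *)
Lemma linear_program_duality (R : realFieldType) (V : vectType R) (I : finType)
  (L : I -> V -> R) (b : I -> R) (c : V -> R) (v0 : V) (t0 : R) :
  (forall i, scalar (L i)) -> scalar c ->
  (forall i, b i <= L i v0) ->
  (forall v, (forall i, b i <= L i v) -> t0 <= c v) ->
  exists v (y : I -> R), [/\ forall i, b i <= L i v, forall i, 0 <= y i,
    forall w, \sum_i y i * L i w = c w & \sum_i y i * b i = c v].
Proof.
move=> Llin clin v0P t0P.
pose e := vbasis {:V}; pose vec (x : 'cV[R]_(\dim {:V})) := 
  \sum_(j < \dim {:V}) x j 0 *: e`_j.
have vecE f : scalar f -> forall x, f (vec x) = \sum_(j < \dim {:V}) f e`_j * x j 0.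
  move=> flin x.
  pose fL : {scalar V} := HB.pack f (GRing.isLinear.Build R V R *%R f flin).
  rewrite -[f]/(fL : V -> R) linear_sum.
  by apply: eq_bigr => j _; rewrite scalarZ mulrC.
pose coords v : 'cV[R]_(\dim {:V}) := \col_j coord e j v.
have vE v : v = vec (coords v).
  by rewrite [LHS](coord_vbasis (memvf v)); apply: eq_bigr => j _; rewrite mxE.
pose A : 'M[R]_(#|I|, \dim {:V}) := \matrix_(i, j) L (enum_val i) e`_j.
pose bb : 'cV[R]_#|I| := \col_i b (enum_val i).
pose cc : 'rV[R]_(\dim {:V}) := \row_j c e`_j.
have AE x i : (A *m x) (enum_rank i) 0 = L i (vec x).
  by rewrite vecE // mxE; apply: eq_bigr => j _; rewrite mxE enum_rankK.
have cE x : (cc *m x) 0 0 = c (vec x).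
  by rewrite vecE // mxE; apply: eq_bigr => j _; rewrite mxE.
have feasE x : (forall i, bb i 0 <= (A *m x) i 0) <-> (forall i, b i <= L i (vec x)).
  split=> h i; first by have := h (enum_rank i); rewrite AE mxE enum_rankK.
  by rewrite -[i]enum_valK AE mxE enum_rankK.
have [||x [y [xP y0 yA yb]]] :=
    @linear_program_duality_mx R _ _ A bb cc (coords v0) t0.
- by apply/feasE => i; rewrite -vE.
- by move=> x /feasE/t0P; rewrite cE.
have sumE (F : 'I_#|I| -> R) : \sum_i F (enum_rank i) = \sum_i F i.
  rewrite [RHS](reindex enum_rank) //.
  by exists enum_val => i _; rewrite ?enum_rankK ?enum_valK.
exists (vec x), (fun i => y 0 (enum_rank i)); split=> //.
- by apply/feasE.
- move=> w; rewrite [w in RHS]vE -cE -yA -mulmxA mxE -sumE.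
  by apply: eq_bigr => i _; rewrite AE -vE.
- rewrite -cE -yb mxE -sumE.
  by apply: eq_bigr => i _; rewrite mxE enum_rankK.
Qed.

(** * Expectations over the finite alphabet *)

Lemma letter_bij (R : realType) (d N : nat) (z : N.+1.-tuple 'rV[R]_d) :
  uniq z -> bijective (letter z).
Proof.
move=> z_uniq; apply: inj_card_bij => [i j /(congr1 val)|].
  exact: (tuple_uniqP _ _ _ _).
by rewrite card_seq_sub // size_tuple card_ord.
Qed.

Lemma mean_pmf (R : realType) (d N : nat) (z : N.+1.-tuple 'rV[R]_d)
  (P : probability (alphabet z) R) (f : alphabet z -> R) :
  uniq z -> mean P f = \sum_j fine (P [set letter z j]) * f (letter z j).
Proof.
move=> z_uniq; have [unletter letterK unletterK] := letter_bij z_uniq.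
pose g j : alphabet z -> R := f (letter z j) \o* \1_[set letter z j].
(* Decompose [f] into multiples of indicators of letters, written as a sum over a list of random
   variables to fit [expectation_sum]. *)
have fE : f = \sum_(X <- [seq g j | j <- index_enum 'I_N.+1]) X.
  apply/funext => x; rewrite big_map fct_sumE (bigD1 (unletter x)) //=.
  rewrite big1 => [|j jx]; rewrite /g /= indicE.
    by rewrite unletterK mem_set // mul1r addr0.
  by rewrite memNset ?mul0r // => /= xj; rewrite xj letterK eqxx in jx.
have indic_Lfun j : (\1_[set letter z j] : alphabet z -> R) \in Lfun P 1.
  by apply/Lfun1_integrable/integrable_indic; rewrite //= fin_num_fun_lty.
rewrite /mean {1}fE expectation_sum => [|Xi /mapP[j _ ->]]; last exact/Lfun_scale.
rewrite big_map -sum_fine => [|j _]; last first.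
  by rewrite expectation_fin_num // Lfun_scale.
apply: eq_bigr => j _; rewrite expectationZl // expectation_indic //.
by rewrite fineM ?fin_num_measure //= mulrC.
Qed.

(** * Linear forms and probability vectors *)

Section scalar_forms.
Variables (R : comRingType) (V : lmodType R).
Implicit Types f g : V -> R.

Lemma scalarD_form f g : scalar f -> scalar g -> scalar (fun v => f v + g v).
Proof. by move=> fP gP a u v; rewrite fP gP; ring. Qed.

Lemma scalarN_form f : scalar f -> scalar (fun v => - f v).
Proof. by move=> fP a u v; rewrite fP; ring. Qed.

Lemma scalarMr_form f c : scalar f -> scalar (fun v => f v * c).
Proof. by move=> fP a u v; rewrite fP; ring. Qed.

Lemma scalarMl_form f c : scalar f -> scalar (fun v => c * f v).
Proof. by move=> fP a u v; rewrite fP; ring. Qed.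

Lemma scalar_sum_form (I : finType) (F : I -> V -> R) :
  (forall i, scalar (F i)) -> scalar (fun v => \sum_i F i v).
Proof.
by move=> FP a u v; rewrite mulr_sumr -big_split; apply: eq_bigr => i _; apply: FP.
Qed.

End scalar_forms.

(** Restores the upper bounds of [in_unit_box] for solutions of the linear programs below, which
    encode nonnegativity and sums equal to 1. *)
Lemma ler1_pmf (R : numDomainType) (I : finType) (p : I -> R) :
  (forall i, 0 <= p i) -> \sum_i p i = 1 -> forall i, p i <= 1.
Proof.
by move=> p0 <- i; rewrite (bigD1 i) //= lerDl sumr_ge0.
Qed.

Lemma mulmx_trE (R : pzRingType) (n : nat) (u v : 'cV[R]_n) :
  (u^T *m v) 0 0 = \sum_j u j 0 * v j 0.
Proof. by rewrite mxE; apply: eq_bigr => j _; rewrite mxE. Qed.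

Lemma mulmx_tr_const1 (R : nzRingType) (n : nat) (p : 'cV[R]_n) :
  p^T *m const_mx 1 = 1%:M <-> \sum_j p j 0 = 1.
Proof.
have E : (p^T *m const_mx 1 : 'M[R]_1) 0 0 = \sum_j p j 0.
  by rewrite mulmx_trE; apply: eq_bigr => j _; rewrite mxE mulr1.
split=> [h|h]; first by rewrite -E h mxE.
by rewrite [LHS]mx11_scalar E h.
Qed.

(** * Duality for a single hypothesis *)

(** This is duality for minimizing [\sum_j w j * p j 0] over a moment polytope; maximizing the risk
    amounts to such a minimization for each hypothesis. The two sides of a moment constraint carry
    the multipliers [ll] and [lu], and the total mass carries [mu]. *)
Lemma moment_problem_duality (R : realFieldType) (n K : nat)
  (f : 'I_K -> 'I_n -> R) (a b : 'I_K -> R) (w : 'I_n -> R) (p0 : 'cV[R]_n) :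
  let feasible (p : 'cV[R]_n) := [/\ forall j, 0 <= p j 0,
    forall k, a k <= \sum_j p j 0 * f k j <= b k & \sum_j p j 0 = 1] in
  feasible p0 ->
  exists p ll lu mu, [/\ feasible p, forall k, 0 <= ll k, forall k, 0 <= lu k,
    forall j, 0 <= w j - \sum_k ll k * f k j + \sum_k lu k * f k j - mu
    & \sum_k ll k * a k - \sum_k lu k * b k + mu = \sum_j w j * p j 0].
Proof.
move=> feasible p0P.
pose L (i : 'I_n + ('I_K + 'I_K) + bool) (p : 'cV[R]_n) : R := match i with
  | inl (inl j) => p j 0
  | inl (inr (inl k)) => \sum_j p j 0 * f k j
  | inl (inr (inr k)) => - \sum_j p j 0 * f k j
  | inr true => \sum_j p j 0
  | inr false => - \sum_j p j 0 end.
pose rhs (i : 'I_n + ('I_K + 'I_K) + bool) : R := match i with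
  | inl (inl j) => 0 | inl (inr (inl k)) => a k | inl (inr (inr k)) => - b k
  | inr true => 1 | inr false => - 1 end.
pose cost (p : 'cV[R]_n) := \sum_j w j * p j 0.
have entry j : scalar (fun p : 'cV[R]_n => p j 0).
  by move=> c u v; rewrite !mxE.
have Llin i : scalar (L i).
  case: i => [[j|[k|k]]|[]] /=; [exact: entry|..];
  do ?apply: scalarN_form; apply: scalar_sum_form => j //;
  exact: scalarMr_form.
have costlin : scalar cost by apply: scalar_sum_form => j; apply: scalarMl_form.
have feasibleP p : (forall i, rhs i <= L i p) <-> feasible p.
  split=> [h|[p_ge0 pab p1] [[j|[k|k]]|[]] //=]; last 4 first.
  - by case/andP: (pab k).
  - by rewrite lerN2; case/andP: (pab k).
  - by rewrite p1.
  - by rewrite p1.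
  split=> [j|k|]; first exact: h (inl (inl j)).
    rewrite (h (inl (inr (inl k)))) /= -lerN2.
    exact: (h (inl (inr (inr k)))).
  apply/le_anti; rewrite (h (inr true)) andbT -lerN2.
  exact: (h (inr false)).
(* On the simplex every entry of [p] is at most 1, so the cost is bounded below. *)
have costb p : (forall i, rhs i <= L i p) -> - \sum_j `|w j| <= cost p.
  move/feasibleP => [p_ge0 _ p1]; rewrite -sumrN ler_sum // => j _.
  have p_le1 := ler1_pmf p_ge0 p1 j.
  rewrite lerNl -mulNr (le_trans (ler_norm _)) // normrM normrN.
  by rewrite (ger0_norm (p_ge0 j)) ler_piMr.
have [p [y [pP y0 yL yrhs]]] :=
  linear_program_duality Llin costlin ((feasibleP _).2 p0P) costb.
pose ll k := y (inl (inr (inl k))); pose lu k := y (inl (inr (inr k))).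
have yE g : \sum_i y i * g i = \sum_j y (inl (inl j)) * g (inl (inl j)) +
    (\sum_k ll k * g (inl (inr (inl k))) + \sum_k lu k * g (inl (inr (inr k)))) +
    (y (inr true) * g (inr true) + y (inr false) * g (inr false)).
  by rewrite !big_sumType big_bool.
have sumMN (g : 'I_K -> R) : \sum_k lu k * - g k = - \sum_k lu k * g k.
  by rewrite -sumrN; apply: eq_bigr => k _; rewrite mulrN.
(* The equality of total mass was split into two inequalities; the difference of their multipliers
   has free sign. *)
exists p, ll, lu, (y (inr true) - y (inr false)).
split; [exact/feasibleP|by move=> k; apply: y0|by move=> k; apply: y0|move=> j|].
  (* Evaluate the dual identity at the unit vector [e]: the slack is the multiplier of [0 <= p j 0],
     hence nonnegative. *)
  pose e : 'cV[R]_n := delta_mx j 0.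
  have deltaE (g : 'I_n -> R) : \sum_i e i 0 * g i = g j.
    rewrite (bigD1 j) //= big1 => [|i /negbTE ij]; rewrite mxE ?ij ?mul0r //.
    by rewrite !eqxx mul1r addr0.
  have sum_e : \sum_i e i 0 = 1.
    by rewrite -[RHS](deltaE (fun=> 1)); apply: eq_bigr => i _; rewrite mulr1.
  have cost_e : cost e = w j.
    by rewrite -[RHS]deltaE; apply: eq_bigr => i _; rewrite mulrC.
  have eE : \sum_i y (inl (inl i)) * e i 0 = y (inl (inl j)).
    by rewrite -[RHS](deltaE (y \o inl \o inl)); apply: eq_bigr => i _; rewrite mulrC.
  have momE (l : 'I_K -> R) :
      \sum_k l k * (\sum_i e i 0 * f k i) = \sum_k l k * f k j.
    by apply: eq_bigr => k _; rewrite deltaE.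
  have := yL e; rewrite cost_e => <-.
  rewrite yE /= sumMN !momE eE sum_e.
  have := y0 (inl (inl j)); lra.
rewrite -/(cost p) -yrhs yE /= sumMN.
by rewrite [X in _ = X + _ + _]big1 => [|j _]; [ring|rewrite mulr0].
Qed.

(** * The inner maximum and the merged linear program *)

Section reformulation.
Context {R : realType} {d N m K : nat}.
Variable z : N.+1.-tuple 'rV[R]_d.
Hypothesis z_uniq : uniq z.
Hypothesis m_gt0 : (0 < m)%N.
Variable psi : 'I_K -> alphabet z -> R.
Variables (n : 'I_m -> nat) (xhat : forall i : 'I_m, (n i).+1.-tuple (alphabet z)).
Variable eta : R.
Hypothesis eta_ge0 : 0 <= eta.

Let a := lower_moment psi xhat eta.
Let b := upper_moment psi xhat eta.

(** Separates the hypotheses and puts each block in the form of [moment_problem_duality]. *)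
Lemma minmax_constraintP (P : 'I_m -> 'cV[R]_N.+1) :
  minmax_constraint psi xhat eta P <-> forall i, [/\ forall j, 0 <= P i j 0,
    forall k, a i k <= \sum_j P i j 0 * psi k (letter z j) <= b i k &
    \sum_j P i j 0 = 1].
Proof.
split=> [[P01 PE P1] i|h].
  split=> [j|k|]; first by case/andP: (P01 i j).
    by have := PE i k; rewrite ler_distl.
  exact/mulmx_tr_const1.
split=> [i j|i k|i]; have [P0 PE P1] := h i; last exact/mulmx_tr_const1.
  by rewrite P0 (ler1_pmf P0 P1).
by rewrite ler_distl; apply: PE.
Qed.

(** Each empirical distribution has deviation 0 from its own moments. It serves as the starting
    point for strong duality and as the test point that bounds the merged program below. *)
Lemma empirical_feasible :
  minmax_constraint psi xhat eta
    (fun i => \col_j fine (Qhat xhat i [set letter z j])).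
Proof.
apply/minmax_constraintP => i; split=> [j|k|].
- by rewrite mxE fine_ge0.
- rewrite (_ : \sum_j _ = mean (Qhat xhat i) (psi k)).
    by rewrite /a /b /lower_moment /upper_moment gerBl lerDl eta_ge0.
  by rewrite mean_pmf //; apply: eq_bigr => j _; rewrite mxE.
(* The total mass is the mean of the constant 1, which brings it under [mean_pmf]. *)
- transitivity (mean (Qhat xhat i) (cst 1)).
    by rewrite mean_pmf //; apply: eq_bigr => j _; rewrite mxE mulr1.
  by rewrite /mean expectation_cst.
Qed.

Lemma riskE (phi P : 'I_m -> 'cV[R]_N.+1) :
  risk phi P = 1 - \sum_i \sum_j m%:R^-1 * phi i j 0 * P i j 0.
Proof.
rewrite /risk mulr_sumr; congr (_ - _); apply: eq_bigr => i _.
by rewrite mulmx_trE mulr_sumr; apply: eq_bigr => j _; rewrite mulrA.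
Qed.

Lemma min_objectiveE (ll lu : 'I_m -> 'I_K -> R) (mu : 'I_m -> R) :
  min_objective psi xhat eta ll lu mu =
  1 - \sum_i (\sum_k ll i k * a i k - \sum_k lu i k * b i k + mu i).
Proof. by rewrite /min_objective big_split /= sumrB; ring. Qed.

(** Weight the dual constraint at letter [j] by [P i j 0] and sum over [j]: [mu i] keeps coefficient
    1, and the moment bounds replace the moments of [P i]. *)
Lemma weak_duality phi ll lu mu P :
  min_constraint psi phi ll lu mu -> minmax_constraint psi xhat eta P ->
  risk phi P <= min_objective psi xhat eta ll lu mu.
Proof.
case=> _ ll0 lu0 dual _ /minmax_constraintP h.
rewrite riskE min_objectiveE lerD2l lerN2 ler_sum // => i _.
have [P0 PE P1] := h i.
have : 0 <= \sum_j P i j 0 * (m%:R^-1 * phi i j 0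
    - \sum_k ll i k * psi k (letter z j) + \sum_k lu i k * psi k (letter z j) - mu i).
  by rewrite sumr_ge0 // => j _; rewrite mulr_ge0.
have swap (l : 'I_K -> R) : \sum_j P i j 0 * (\sum_k l k * psi k (letter z j)) =
    \sum_k l k * \sum_j P i j 0 * psi k (letter z j).
  under eq_bigr do rewrite mulr_sumr; rewrite exchange_big /=.
  by apply: eq_bigr => k _; rewrite mulr_sumr; apply: eq_bigr => j _; rewrite mulrCA.
rewrite (eq_bigr _ (fun j _ => mulrBr _ _ _)) sumrB.
rewrite (eq_bigr _ (fun j _ => mulrDr _ _ _)) big_split /=.
rewrite (eq_bigr _ (fun j _ => mulrBr _ _ _)) sumrB !swap -mulr_suml P1 mul1r.
have -> : \sum_j P i j 0 * (m%:R^-1 * phi i j 0) = \sum_j m%:R^-1 * phi i j 0 * P i j 0.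
  by apply: eq_bigr => j _; rewrite mulrC.
have : \sum_k ll i k * a i k <= \sum_k ll i k * \sum_j P i j 0 * psi k (letter z j).
  by apply: ler_sum => k _; rewrite ler_wpM2l //; case/andP: (PE k).
have : \sum_k lu i k * \sum_j P i j 0 * psi k (letter z j) <= \sum_k lu i k * b i k.
  by apply: ler_sum => k _; rewrite ler_wpM2l //; case/andP: (PE k).
lra.
Qed.

Lemma strong_duality phi : decision_rule phi ->
  exists P ll lu mu, [/\ minmax_constraint psi xhat eta P,
    min_constraint psi phi ll lu mu &
    min_objective psi xhat eta ll lu mu = risk phi P].
Proof.
move=> [phi01 phi1].
have /minmax_constraintP q := empirical_feasible.
(* Solve the program of each hypothesis separately; the tuple lets one use of choice collect the
   minimizers and all multipliers. *)
have /choice[s sP] : forall i, exists s : 'cV[R]_N.+1 * ('I_K -> R) * ('I_K -> R) * R,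
    [/\ [/\ forall j, 0 <= s.1.1.1 j 0,
      forall k, a i k <= \sum_j s.1.1.1 j 0 * psi k (letter z j) <= b i k
      & \sum_j s.1.1.1 j 0 = 1],
      forall k, 0 <= s.1.1.2 k, forall k, 0 <= s.1.2 k,
      forall j, 0 <= m%:R^-1 * phi i j 0 - \sum_k s.1.1.2 k * psi k (letter z j)
        + \sum_k s.1.2 k * psi k (letter z j) - s.2
    & \sum_k s.1.1.2 k * a i k - \sum_k s.1.2 k * b i k + s.2 =
      \sum_j m%:R^-1 * phi i j 0 * s.1.1.1 j 0].
  move=> i.
  have [p [ll [lu [mu h]]]] := moment_problem_duality (fun j => m%:R^-1 * phi i j 0) (q i).
  by exists (p, ll, lu, mu).
exists (fun i => (s i).1.1.1), (fun i => (s i).1.1.2), (fun i => (s i).1.2),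
  (fun i => (s i).2).
split.
- by apply/minmax_constraintP => i; case: (sP i).
- by split=> // [i|i|j i]; case: (sP i).
- by rewrite min_objectiveE riskE; congr (_ - _); apply: eq_bigr => i _; case: (sP i).
Qed.

Lemma worst_riskE phi P ll lu mu :
  minmax_constraint psi xhat eta P -> min_constraint psi phi ll lu mu ->
  min_objective psi xhat eta ll lu mu = risk phi P ->
  worst_risk psi xhat eta phi = (risk phi P)%:E.
Proof.
move=> PP dualP E; apply/le_anti/andP; split; last first.
  by apply: ereal_sup_ubound; exists P.
apply: ge_ereal_sup => _ [P' P'P <-].
by rewrite lee_fin -E weak_duality.
Qed.

(** With [phi] itself a variable, objective and constraints are still jointly affine, so the whole
    problem is one linear program over [V]. *)
Lemma min_attained : exists phi ll lu mu, min_constraint psi phi ll lu mu /\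
  forall phi' ll' lu' mu', min_constraint psi phi' ll' lu' mu' ->
    min_objective psi xhat eta ll lu mu <= min_objective psi xhat eta ll' lu' mu'.
Proof.
pose V := ('M[R]_(m, N.+1) * 'M[R]_(m, K) * 'M[R]_(m, K) * 'cV[R]_m)%type.
pose phi_ (v : V) i : 'cV[R]_N.+1 := (row i v.1.1.1)^T.
pose ll_ (v : V) i k := v.1.1.2 i k.
pose lu_ (v : V) i k := v.1.2 i k.
pose mu_ (v : V) i := v.2 i 0.
pose I := ('I_m * 'I_N.+1 + ('I_m * 'I_K + 'I_m * 'I_K) +
  ('I_N.+1 * 'I_m + 'I_N.+1 * bool))%type.
pose L (i : I) (v : V) : R := match i with
  | inl (inl ij) => phi_ v ij.1 ij.2 0
  | inl (inr (inl ik)) => ll_ v ik.1 ik.2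
  | inl (inr (inr ik)) => lu_ v ik.1 ik.2
  | inr (inl ji) => m%:R^-1 * phi_ v ji.2 ji.1 0
      - \sum_k ll_ v ji.2 k * psi k (letter z ji.1)
      + \sum_k lu_ v ji.2 k * psi k (letter z ji.1) - mu_ v ji.2
  | inr (inr (j, true)) => \sum_i phi_ v i j 0
  | inr (inr (j, false)) => - \sum_i phi_ v i j 0 end.
pose rhs (i : I) : R := match i with
  | inr (inr (j, true)) => 1 | inr (inr (j, false)) => -1 | _ => 0 end.
(* The constant 1 of the objective is dropped to make the cost linear. *)
pose cost (v : V) := - \sum_i (\sum_k ll_ v i k * a i k
  - \sum_k lu_ v i k * b i k + mu_ v i).
have philin i j : scalar (fun v => phi_ v i j 0) by move=> c u v; rewrite !mxE.
have lllin i k : scalar (fun v => ll_ v i k) by move=> c u v; rewrite /ll_ /= !mxE.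
have lulin i k : scalar (fun v => lu_ v i k) by move=> c u v; rewrite /lu_ /= !mxE.
have mulin i : scalar (fun v => mu_ v i) by move=> c u v; rewrite /mu_ /= !mxE.
have costlin : scalar cost.
  apply: scalarN_form; apply: scalar_sum_form => i.
  apply: scalarD_form; last exact: mulin.
  apply: scalarD_form; first by apply: scalar_sum_form => k; apply: scalarMr_form.
  by apply: scalarN_form; apply: scalar_sum_form => k; apply: scalarMr_form.
have Llin i : scalar (L i).
  case: i => [[[i j]|[[i k]|[i k]]]|[[j i]|[j []]]];
    [exact: philin|exact: lllin|exact: lulin| |exact: scalar_sum_form|
     by apply: scalarN_form; apply: scalar_sum_form].
  rewrite /L /=; apply: scalarD_form; last exact/scalarN_form/mulin.
  apply: scalarD_form; last by apply: scalar_sum_form => k; apply: scalarMr_form.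
  apply: scalarD_form; first exact: scalarMl_form.
  by apply: scalarN_form; apply: scalar_sum_form => k; apply: scalarMr_form.
have constraintP v : (forall i, rhs i <= L i v) <->
    min_constraint psi (phi_ v) (ll_ v) (lu_ v) (mu_ v).
  split=> [h|[phi01 ll0 lu0 dual phi1]].
    have phi0 i j : 0 <= phi_ v i j 0 by exact: (h (inl (inl (i, j)))).
    have phi1 j : \sum_i phi_ v i j 0 = 1.
      apply/le_anti; rewrite (h (inr (inr (j, true)))) andbT -lerN2.
      exact: (h (inr (inr (j, false)))).
    split=> [i j|i k|i k|j i|//].
    - by rewrite phi0 (ler1_pmf (fun i => phi0 i j) (phi1 j)).
    - exact: (h (inl (inr (inl (i, k))))).
    - exact: (h (inl (inr (inr (i, k))))).
    - exact: (h (inr (inl (j, i)))).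
  case=> [[[i j]|[[i k]|[i k]]]|[[j i]|[j []]]] //=; rewrite ?phi1 //.
  by case/andP: (phi01 i j).
pose pack (phi : 'I_m -> 'cV[R]_N.+1) ll lu mu : V :=
  (\matrix_(i, j) phi i j 0, \matrix_(i, k) ll i k, \matrix_(i, k) lu i k, \col_i mu i).
have packE phi ll lu mu : [/\ phi_ (pack phi ll lu mu) = phi, ll_ (pack phi ll lu mu) = ll,
    lu_ (pack phi ll lu mu) = lu & mu_ (pack phi ll lu mu) = mu].
  split; apply/funext => i; last by rewrite /mu_ mxE.
  - by apply/matrixP => j o; rewrite !mxE ord1.
  - by apply/funext => k; rewrite /ll_ mxE.
  - by apply/funext => k; rewrite /lu_ mxE.
have costE v : cost v = min_objective psi xhat eta (ll_ v) (lu_ v) (mu_ v) - 1.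
  by rewrite min_objectiveE /cost; ring.
have mR0 : m%:R != 0 :> R by rewrite pnatr_eq0 -lt0n.
(* The uniform rule with all multipliers zero is feasible. *)
pose v0 := pack (fun=> const_mx m%:R^-1) (fun _ _ => 0) (fun _ _ => 0) (fun=> 0).
have v0P i : rhs i <= L i v0.
  move: i; apply/constraintP; rewrite /v0.
  have [-> -> -> ->] := packE (fun=> const_mx m%:R^-1) (fun _ _ => 0) (fun _ _ => 0) (fun=> 0).
  split=> // [i j|j i|j].
  - by rewrite mxE invr_ge0 ler0n invf_le1 ?ltr0n // ler1n.
  - rewrite mxE; under eq_bigr do rewrite mul0r.
    rewrite big1_eq subr0 addr0 subr0.
    by rewrite mulr_ge0 // invr_ge0 ler0n.
  - under eq_bigr do rewrite mxE.
    by rewrite sumr_const card_ord -[LHS]mulr_natr mulVf.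
(* Weak duality against the empirical distributions bounds the objective below by a risk, which is
   nonnegative because [phi] is at most 1. *)
have costb v : (forall i, rhs i <= L i v) -> -1 <= cost v.
  move/constraintP => vP; rewrite costE lerBrDr addNr.
  have qP := empirical_feasible.
  apply: le_trans (weak_duality vP qP); case: vP => phi01 _ _ _ phi1.
  move/minmax_constraintP in qP.
  rewrite riskE subr_ge0.
  have sumV : \sum_(i < m) m%:R^-1 = 1 :> R.
    by rewrite sumr_const card_ord -[LHS]mulr_natr mulVf.
  rewrite -[leRHS]sumV; apply: ler_sum => i _; have [p0 _ p1] := qP i.
  rewrite -[leRHS]mulr1 -[X in _ <= _ * X]p1 mulr_sumr; apply: ler_sum => j _.
  rewrite ler_wpM2r // ler_piMr ?invr_ge0 ?ler0n //.
  by case/andP: (phi01 i j).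
have [v [y [vP y0 yL yrhs]]] := linear_program_duality Llin costlin v0P costb.
exists (phi_ v), (ll_ v), (lu_ v), (mu_ v); split; first exact/constraintP.
move=> phi' ll' lu' mu' h'.
have [e1 e2 e3 e4] := packE phi' ll' lu' mu'.
have := costE (pack phi' ll' lu' mu'); rewrite e2 e3 e4 => E.
(* The multipliers [y] certify optimality: the cost at [v] is [\sum_i y i * rhs i], at most
   [\sum_i y i * L i] at any feasible point, which is the cost there. *)
rewrite -(lerD2r (-1)) -E -costE -yrhs -yL ler_sum // => i _.
rewrite ler_wpM2l //; move: i; apply/constraintP.
by rewrite e1 e2 e3 e4.
Qed.

End reformulation.

(** * Comparison of the two problems *)

Theorem theorem2 (R : realType) (d N m K : nat)
  (z : N.+1.-tuple 'rV[R]_d) (z_uniq : uniq z)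
  (m_ge2 : (2 <= m)%N)
  (psi : 'I_K -> alphabet z -> R)
  (n : 'I_m -> nat) (xhat : forall i : 'I_m, (n i).+1.-tuple (alphabet z))
  (eta : R) (eta_gt0 : 0 < eta) (eta_lt : (eta%:E < eta_max psi xhat)%E) :
  [/\ forall phi : 'I_m -> 'cV[R]_N.+1, decision_rule phi ->
        exists2 P : 'I_m -> 'cV[R]_N.+1,
          minmax_constraint psi xhat eta P & (risk phi P)%:E = worst_risk psi xhat eta phi,
      exists phi : 'I_m -> 'cV[R]_N.+1, minmax_optimal psi xhat eta phi,
      minmax_value psi xhat eta = min_value psi xhat eta
    & forall phi : 'I_m -> 'cV[R]_N.+1,
        minmax_optimal psi xhat eta phi <-> min_optimal psi xhat eta phi].
Proof.
have m_gt0 : (0 < m)%N by apply: ltnW.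
have eta_ge0 := ltW eta_gt0.
pose obj := min_objective psi xhat eta.
(* For each rule the inner maximum is attained, and some multipliers make the merged objective equal
   to it. *)
have certificate phi : decision_rule phi -> exists P ll lu mu,
    [/\ minmax_constraint psi xhat eta P, min_constraint psi phi ll lu mu,
      worst_risk psi xhat eta phi = (risk phi P)%:E & obj ll lu mu = risk phi P].
  move=> phiP; have [P [ll [lu [mu [PP dualP E]]]]] :=
    strong_duality z_uniq psi xhat eta_ge0 phiP.
  by exists P, ll, lu, mu; split=> //; apply: worst_riskE dualP E.
have [phi0 [ll0 [lu0 [mu0 [dual0 min0]]]]] := min_attained z_uniq m_gt0 psi xhat eta_ge0.
have rule phi ll lu mu : min_constraint psi phi ll lu mu -> decision_rule phi by case.
have worst_le phi ll lu mu : min_constraint psi phi ll lu mu ->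
    (worst_risk psi xhat eta phi <= (obj ll lu mu)%:E)%E.
  move=> dual; apply: ge_ereal_sup => _ [P PP <-].
  by rewrite lee_fin; apply: weak_duality.
(* The worst risk of a rule is the objective at a feasible point of the merged problem, so it is at
   least the merged minimum. *)
have worst_ge phi : decision_rule phi ->
    ((obj ll0 lu0 mu0)%:E <= worst_risk psi xhat eta phi)%E.
  move=> /certificate[P [ll [lu [mu [_ dual -> <-]]]]].
  by rewrite lee_fin; apply: min0 dual.
have minmaxE : minmax_value psi xhat eta = (obj ll0 lu0 mu0)%:E.
  apply/le_anti/andP; split.
    apply: le_trans (worst_le _ _ _ _ dual0).
    by apply: ereal_inf_lbound; exists phi0 => //; apply: rule dual0.
  by apply: le_ereal_inf_tmp => _ [phi phiP <-]; apply: worst_ge.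
have minE : min_value psi xhat eta = (obj ll0 lu0 mu0)%:E.
  apply/le_anti/andP; split.
    by apply: ereal_inf_lbound; exists phi0, ll0, lu0, mu0.
  apply: le_ereal_inf_tmp => _ [phi [ll [lu [mu [dual ->]]]]].
  by rewrite lee_fin; apply: min0 dual.
split.
- by move=> phi /certificate[P [ll [lu [mu [PP _ -> _]]]]]; exists P.
- exists phi0; split; first exact: rule dual0.
  apply/le_anti; rewrite minmaxE worst_le //= worst_ge //.
  exact: rule dual0.
- by rewrite minmaxE minE.
move=> phi; split=> [[phiP worstE]|[ll [lu [mu [dual E]]]]].
  (* The certifying multipliers complete an optimal rule to an optimal solution. *)
  have [P [ll [lu [mu [_ dual worst_risk_eq objE]]]]] := certificate _ phiP.
  exists ll, lu, mu; split=> //.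
  by rewrite -/(obj ll lu mu) objE -worst_risk_eq worstE minmaxE minE.
(* Conversely, weak duality puts the worst risk of [phi] at or below the common value, and
   [worst_ge] at or above it. *)
split; first exact: rule dual.
apply/le_anti; rewrite {2}minmaxE worst_ge ?andbT; last exact: rule dual.
by rewrite minmaxE -minE -E; apply: worst_le.
Qed.
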